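(* Let $k\geq 3$ and let $\mathcal{G}$ be a $k$-uniform supertree of order $n$. Then $\rho(\mathcal{G})\leq\rho(\mathcal{S}^{\ast}(n, k))$, with equality if and only if $\mathcal{G}\cong \mathcal{S}^{\ast}(n, k)$.
   Context: A hypergraph $\mathcal{G}=(V,E)$ has a nonempty finite vertex set $V$ and a set $E$ of distinct edges, each edge being a subset of $V$ with at least two vertices; $n=|V|$ is the order and $m=|E|$ the number of edges. It is $k$-uniform if every edge has exactly $k$ vertices. Its adjacency matrix $\mathcal{A}_{\mathcal{G}}$ is the $n\times n$ matrix with $(\mathcal{A}_{\mathcal{G}})_{ij}=\sum_{e\in E,\ i,j\in e}\frac{1}{|e|-1}$ for $i\neq j$ (and $0$ on the diagonal), and the spectral radius $\rho(\mathcal{G})$ is the largest modulus of an eigenvalue of $\mathcal{A}_{\mathcal{G}}$. A hypergraph is connected if any two vertices are joined by a sequence of edges in which consecutive edges intersect. It is acyclic if it contains no (Berge) cycle, i.e. no sequence $v_1e_1v_2e_2\cdots v_qe_qv_1$ with $q\ge 2$, distinct vertices $v_i$, distinct edges $e_i$, and $v_i,v_{i+1}\in e_i$ (indices mod $q$). A supertree is a connected acyclic hypergraph; in particular any two edges of a supertree share at most one vertex, and a $k$-uniform supertree of order $n$ has $\frac{n-1}{k-1}$ edges. The $k$-uniform superstar $\mathcal{S}^{\ast}(n,k)$ of order $n$ is the $k$-uniform supertree in which all edges contain one common vertex (and pairwise meet only in that vertex). Isomorphism of hypergraphs means a vertex bijection mapping edges to edges. *)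

(* Defs.v *)
From HB Require Import structures.
From mathcomp Require Import all_boot all_order all_algebra all_field.
Set Implicit Arguments. Unset Strict Implicit. Unset Printing Implicit Defensive.
Import Order.TTheory GRing.Theory Num.Theory.
Local Open Scope ring_scope.

Definition hypergraph (n : nat) (E : {set {set 'I_n}}) : Prop :=
  forall e, e \in E -> (2 <= #|e|)%N.

Definition uniform (n k : nat) (E : {set {set 'I_n}}) : Prop :=
  forall e, e \in E -> #|e| = k.

Definition hconnected (n : nat) (E : {set {set 'I_n}}) : Prop :=
  forall u v : 'I_n, u != v ->
    exists (e0 : {set 'I_n}) (es : seq {set 'I_n}),
      [/\ all (fun e => e \in E) (e0 :: es),
          u \in e0, v \in last e0 es &
          path (fun a b : {set 'I_n} => [exists x : 'I_n, (x \in a) && (x \in b)]) e0 es].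

Definition berge_cycle (n : nat) (E : {set {set 'I_n}}) (q : nat)
    (vs : nat -> 'I_n) (es : nat -> {set 'I_n}) : Prop :=
  [/\ (2 <= q)%N,
      {in [pred i | (i < q)%N] &, injective vs},
      {in [pred i | (i < q)%N] &, injective es} &
      forall i, (i < q)%N ->
        [/\ es i \in E, vs i \in es i & vs (i.+1 %% q)%N \in es i]].

Definition acyclic (n : nat) (E : {set {set 'I_n}}) : Prop :=
  forall q vs es, ~ berge_cycle E q vs es.

Definition supertree (n : nat) (E : {set {set 'I_n}}) : Prop :=
  [/\ hypergraph E, hconnected E & acyclic E].

(* adjacency matrix: A_ij = sum_{e in E, i,j in e} 1/(|e|-1), zero diagonal.
   Entries taken in algC (algebraic complex numbers), where eigenvalues live. *)
Definition adjmx (n : nat) (E : {set {set 'I_n}}) : 'M[algC]_n :=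
  \matrix_(i < n, j < n)
    (if i == j then 0
     else \sum_(e in E | (i \in e) && (j \in e)) ((#|e| - 1)%N%:R)^-1).

Definition spectral_radius (n : nat) (A : 'M[algC]_n) (r : algC) : Prop :=
  (exists2 l, eigenvalue A l & `|l| = r) /\
  (forall l, eigenvalue A l -> `|l| <= r).

Definition hiso (n : nat) (E1 E2 : {set {set 'I_n}}) : Prop :=
  exists f : 'I_n -> 'I_n, bijective f /\ E2 = [set f @: e | e : {set 'I_n} in E1].

(* the k-uniform superstar of order n: center 0, edges
   {0} u {i : 1 <= i, (i-1) %/ (k-1) = j} for j < (n-1)/(k-1)
   (meaningful when (k-1) divides (n-1)) *)
Definition superstar (n k : nat) : {set {set 'I_n}} :=
  [set [set i : 'I_n | (val i == 0%N) ||
          ((0 < val i)%N && ((val i - 1) %/ (k - 1) == val j)%N)]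
   | j : 'I_((n - 1) %/ (k - 1))].

(* Main.v *)
Require Import Defs.
From mathcomp Require Import all_boot all_order all_algebra all_field.
From mathcomp Require Import zify ring.
Import Order.TTheory GRing.Theory Num.Theory.
Set Implicit Arguments. Unset Strict Implicit. Unset Printing Implicit Defensive.

(**
Write [k = t + 1]. Since two edges meet in at most one vertex, [t A = P] is the
0/1 adjacency matrix of the 2-section. Acyclicity makes the number of common
neighbours of [i != j] equal to [t - 1], [1] or [0] according as [i] and [j] are
at distance 1, 2 or more, so [P^2 - (t-1) P = diag(|N(i)|) + P2], where [P2] is
the adjacency matrix of the relation "at distance 2". The row sums
[|N(i)| + |N2(i)|] are divisible by [t] and at most [n - 1], hence at most [t m]
with [m = floor((n-1)/t)], and any eigenvalue [l] of [A] satisfies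
[t |l|^2 - (t-1) |l| <= |t l^2 - (t-1) l| <= m]. The positive root [r] of
[t r^2 - (t-1) r = m] is an eigenvalue of the superstar, which gives the bound.
In the equality case the set of indices where an eigenvector has maximal modulus
is closed under passing to distance 2, and each of its rows sums to [t m], so
fewer than [t] vertices are at distance at least 3 from it; no nonbacktracking
walk of length 3 can then start there, and this forces a vertex adjacent to all
the others.
*)

(** * Nonbacktracking walks *)

Section NonBacktracking.

Variables (n : nat) (E : {set {set 'I_n}}).

(** Nothing relates the last edge to the first, so a closed walk may begin and end with the same
    edge. *)
Definition nbwalk q (vs : nat -> 'I_n) (es : nat -> {set 'I_n}) : Prop :=
  forall i, i < q -> [/\ es i \in E, vs i \in es i, vs i.+1 \in es i,
    vs i != vs i.+1 & (i.+1 < q -> es i != es i.+1)].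

Lemma nbwalk_sub q vs es a l : nbwalk q vs es -> a + l <= q ->
  nbwalk l (fun i => vs (a + i)) (fun i => es (a + i)).
Proof.
move=> w le_q i lt_il; have lt_q : a + i < q by lia.
have [Ei v1 v2 vN eN] := w _ lt_q; rewrite !addnS; split=> // lt_i1.
by apply: eN; lia.
Qed.

(* A shortest closed walk is a Berge cycle: a repeated vertex or a repeated edge
   would yield a shorter closed walk. *)
Lemma acyclic_nbwalk : acyclic E ->
  forall q vs es, 0 < q -> nbwalk q vs es -> vs 0 != vs q.
Proof.
move=> acE q; elim/ltn_ind: q => q IHq vs es q_gt0 w; apply/eqP=> closed.
have sub_open a b : a < b -> b <= q -> b - a < q -> vs a != vs b.
  move=> lt_ab le_bq lt_q.
  have le1 : a + (b - a) <= q by lia.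
  have b_a : 0 < b - a by lia.
  have := IHq _ lt_q _ _ b_a (nbwalk_sub w le1).
  by rewrite addn0 subnKC // ltnW.
have vs_lt a b : a < b -> b < q -> vs a != vs b.
  by move=> lt_ab lt_bq; apply: sub_open; lia.
have es_lt a b : a < b -> b < q -> es a != es b.
  move=> lt_ab lt_bq; apply/eqP=> eq_e.
  have lt_a1q : a.+1 < q by lia.
  have [_ _ va1 _ eN] := w a (ltn_trans lt_ab lt_bq).
  have [Eb vb _ _ _] := w b lt_bq.
  have lt_a1b : a.+1 < b.
    rewrite ltn_neqAle lt_ab andbT; apply/eqP=> eq_b.
    by move: (eN lt_a1q); rewrite eq_b eq_e eqxx.
  have vN := vs_lt _ _ lt_a1b lt_bq.
  (* If [es a = es b], the stretch from [vs a.+1] to [vs b] closes up through this common edge into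
     a walk of length [b - a < q]. *)
  pose vs' i := if i == b - a then vs a.+1 else vs (a.+1 + i).
  have lt_q : b - a < q by lia.
  have ba_gt0 : 0 < b - a by lia.
  have w' : nbwalk (b - a) vs' (fun i => es (a.+1 + i)).
    move=> i lt_i; rewrite /vs' (ltn_eqF lt_i).
    have [eq_i|ne_i] := eqVneq i.+1 (b - a).
      have -> : a.+1 + i = b by lia.
      split=> //; first by rewrite -eq_e.
        by rewrite eq_sym.
      by lia.
    have lt_q' : a.+1 + i < q by lia.
    have [? ? ? ? eN'] := w _ lt_q'.
    by rewrite !addnS; split=> // _; apply: eN'; lia.
  have := IHq _ lt_q _ _ ba_gt0 w'.
  by rewrite /vs' eqxx (ltn_eqF ba_gt0) addn0 eqxx.
have q_gt1 : 1 < q.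
  rewrite ltn_neqAle q_gt0 andbT; apply/eqP=> q1.
  have [_ _ _ + _] := w 0 q_gt0.
  by rewrite closed -q1 eqxx.
apply: (acE q vs es); split=> //.
- move=> i j; rewrite !inE => lt_i lt_j eq_v.
  case: (ltngtP i j) => // lt_ij.
    by move: (vs_lt _ _ lt_ij lt_j); rewrite eq_v eqxx.
  by move: (vs_lt _ _ lt_ij lt_i); rewrite eq_v eqxx.
- move=> i j; rewrite !inE => lt_i lt_j eq_v.
  case: (ltngtP i j) => // lt_ij.
    by move: (es_lt _ _ lt_ij lt_j); rewrite eq_v eqxx.
  by move: (es_lt _ _ lt_ij lt_i); rewrite eq_v eqxx.
- move=> i lt_i; have [Ei v1 v2 _ _] := w i lt_i; split=> //.
  have [eq_i|ne_i] := eqVneq i.+1 q; first by rewrite eq_i modnn closed -eq_i.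
  by rewrite modn_small //; lia.
Qed.

(* [nbw a q e b]: a nonbacktracking walk with [q.+1] edges from [a] to [b],
   the last edge being [e]. *)
Fixpoint nbw (a : 'I_n) (q : nat) (e : {set 'I_n}) (b : 'I_n) : Prop :=
  [/\ e \in E, b \in e &
    match q with
    | 0 => a \in e /\ a != b
    | p.+1 => exists f c, [/\ nbw a p f c, f != e, c \in e & c != b]
    end].

Lemma nbw1 a e b : e \in E -> a \in e -> b \in e -> a != b -> nbw a 0 e b.
Proof. by []. Qed.

Lemma nbwS a q f c e b : nbw a q f c -> e \in E -> f != e -> c \in e ->
  b \in e -> c != b -> nbw a q.+1 e b.
Proof. by move=> w Ee fNe ce be cNb; split=> //; exists f, c. Qed.

Lemma nbw_nbwalk a q e b : nbw a q e b ->
  exists vs es, [/\ nbwalk q.+1 vs es, vs 0 = a, vs q.+1 = b & es q = e].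
Proof.
elim: q e b => [|q IHq] e b.
  case=> Ee be [ae aNb].
  exists (fun i => if i == 0 then a else b), (fun=> e); split=> //.
  by case.
case=> Ee be [f [c [/IHq [vs [es [w v0 vq eq]]] fNe ce cNb]]].
exists (fun i => if i <= q.+1 then vs i else b),
       (fun i => if i <= q then es i else e); split; rewrite ?ltnn //.
move=> i; rewrite ltnS => le_i; rewrite le_i.
have [lt_i|ge_i] := leqP i q; last first.
  have -> : i = q.+1 by lia.
  by rewrite ltnn vq; split; rewrite ?ltnn.
have [? ? ? ? eN] := w i lt_i; have -> : i < q.+1 by [].
split=> // _.
have [lt_iq|ge_iq] := ltnP i q; first exact: eN.
have -> : i = q by lia.
by rewrite eq.
Qed.

Hypothesis acE : acyclic E.

Lemma nbw_open a q e b : nbw a q e b -> a != b.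
Proof.
by case/nbw_nbwalk=> vs [es [w <- <- _]]; apply: acyclic_nbwalk w.
Qed.

(** If [f] is the last edge, the last step is redirected to [c], or dropped when [c] is the previous
    vertex; the drop costs one edge, hence [q.-1]. A one-edge walk may fall back to [a]. *)
Lemma nbw_extend a q e b f c : nbw a q e b -> f \in E -> b \in f -> c \in f ->
  (exists q' e', q.-1 <= q' /\ nbw a q' e' c) \/ q = 0 /\ c = a.
Proof.
move=> w Ef bf cf.
have [->|cNb] := eqVneq c b.
  by left; exists q, e; split=> //; apply: leq_pred.
have [eq_ef|fNe] := eqVneq e f; last first.
  left; exists q.+1, f; split; first by lia.
  by apply: nbwS w _ _ _ _ _; rewrite // eq_sym.
rewrite -{f}eq_ef in Ef bf cf *.
case: q w => [|q] w.
  have [_ _ [ae aNb]] := w.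
  have [->|cNa] := eqVneq c a; first by right.
  by left; exists 0, e; split=> //; apply: nbw1; rewrite // eq_sym.
have [_ _ [f [d [w' fNe de dNb]]]] := w.
left; have [->|cNd] := eqVneq c d; first by exists q, f; split.
exists q.+1, e; split; first by lia.
by apply: nbwS w' _ _ _ _ _; rewrite // eq_sym.
Qed.

(** Distinct edges sharing [i] and [j] would give the closed walk [i], [j], [i]. *)
Lemma linear_edges e f i j : e \in E -> f \in E -> i != j ->
  i \in e -> j \in e -> i \in f -> j \in f -> e = f.
Proof.
move=> Ee Ef iNj ie je if_ jf; apply/eqP; apply: contraT => eNf.
suff /nbw_open : nbw i 1 f i by rewrite eqxx.
by apply: (nbwS (nbw1 Ee ie je iNj)); rewrite // eq_sym.
Qed.

Definition adj i j := (i != j) && [exists e in E, (i \in e) && (j \in e)].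

Lemma adjP i j :
  reflect (i != j /\ exists e, [/\ e \in E, i \in e & j \in e]) (adj i j).
Proof.
apply: (iffP andP) => -[iNj].
  by case/existsP=> e /andP[Ee /andP[ie je]]; split=> //; exists e.
case=> e [Ee ie je]; split=> //; apply/existsP; exists e.
by rewrite Ee ie je.
Qed.

Lemma adjC i j : adj i j = adj j i.
Proof.
by rewrite /adj eq_sym; congr (_ && _); apply: eq_existsb => e; rewrite [X in _ && X]andbC.
Qed.

(** An edge joining [b] to [a] would extend this walk of at least two edges to a closed one. *)
Lemma nbw1_nadj a q e b : nbw a q.+1 e b -> ~~ adj a b.
Proof.
move=> w; apply/negP => /adjP[_ [f [Ef af bf]]].
have [[q' [e' [_ /nbw_open]]]|[]] := nbw_extend w Ef bf af => //.
by rewrite eqxx.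
Qed.

(** Moving on from [b] to [u] leaves a walk of at least two edges, so [u] cannot be adjacent to
    [a]. *)
Lemma nbw2_nadj a q e b u : nbw a q.+2 e b -> ~~ (adj a u && adj u b).
Proof.
move=> w; apply/andP => -[au /adjP[_ [f [Ef uf bf]]]].
have [[[|q'] [e' [// lt_q w']]]|[]] := nbw_extend w Ef bf uf => //.
by move: (nbw1_nadj w'); rewrite au.
Qed.

Lemma adj_triangle e f g i u j : e \in E -> f \in E -> g \in E ->
  i != j -> i != u -> u != j -> i \in e -> j \in e -> i \in f -> u \in f ->
  u \in g -> j \in g -> f = g.
Proof.
move=> Ee Ef Eg iNj iNu uNj ie je if_ uf ug jg; apply/eqP; apply: contraT => fNg.
have w : nbw i 1 g j by apply: (nbwS (nbw1 Ef if_ uf iNu)).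
by case/negP: (nbw1_nadj w); apply/adjP; split=> //; exists e.
Qed.

(** Distinct [u] and [v] would give a walk [i], [u], [j], [v], or [i], [u], [v] when [e2 = e3],
    ending at a neighbour of [i]. *)
Lemma common_adj_unique i j u v : ~~ adj i j -> i != j ->
  adj i u -> adj u j -> adj i v -> adj v j -> u = v.
Proof.
move=> nij iNj iu uj iv vj; apply/eqP; apply: contraT => uNv.
case/adjP: iu => iNu [e1 [E1 ie1 ue1]]; case/adjP: uj => uNj [e2 [E2 ue2 je2]].
case/adjP: (vj) => vNj [e3 [E3 ve3 je3]].
have ne12 : e1 != e2.
  by apply: contraNneq nij => eq12; apply/adjP; split=> //; exists e1; split; rewrite // eq12.
have w := nbw1 E1 ie1 ue1 iNu.
have [eq23|ne23] := eqVneq e2 e3.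
  have w' : nbw i 1 e2 v by apply: nbwS w _ _ _ _ _; rewrite // eq23.
  by move: (nbw1_nadj w'); rewrite iv.
have w' : nbw i 1 e2 j by apply: nbwS w _ _ _ _ _.
have w'' : nbw i 2 e3 v by apply: nbwS w' _ _ _ _ _; rewrite // eq_sym.
by move: (nbw1_nadj w''); rewrite iv.
Qed.

Lemma connected_nbw : hconnected E ->
  forall u v, u != v -> exists q e, nbw u q e v.
Proof.
move=> conE u v uNv; have [e0 [es [all_e ue0 ves pes]]] := conE u v uNv.
(* The induction along the chain carries this claim for every vertex of the current edge. *)
have reach_e0 x : x \in e0 -> x = u \/ exists q e, nbw u q e x.
  move=> xe0; have [->|xNu] := eqVneq x u; first by left.
  right; exists 0, e0; apply: nbw1; rewrite // 1?eq_sym //.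
  by case/andP: all_e.
suff [|//] : v = u \/ exists q e, nbw u q e v.
  by move=> eq_vu; rewrite eq_vu eqxx in uNv.
elim: es e0 all_e {ue0} ves pes reach_e0 => [|e es IHes] e0 /=.
  by move=> _ ve0 _ /(_ v ve0).
case/andP=> E0 /andP[Ee all_e] ves /andP[/existsP[x /andP[xe0 xe]] pes] reach.
apply: (IHes e) => //; first by rewrite /= Ee.
move=> y ye; have [->|yNu] := eqVneq y u; [by left | right].
have [eq_xu|[q [f w]]] := reach x xe0.
  by exists 0, e; apply: nbw1; rewrite // 1?eq_sym // -eq_xu.
have [[q' [e' [_ w']]]|[_ eq_y]] := nbw_extend w Ee xe ye; first by exists q', e'.
by rewrite eq_y eqxx in yNu.
Qed.

End NonBacktracking.

(** * Neighbourhoods of radius two *)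

Section UniformAcyclic.

Variables (n t : nat) (E : {set {set 'I_n}}).
Hypotheses (acE : acyclic E) (unifE : uniform t.+1 E).

Definition nbr i := [set j | adj E i j].

Definition nbr2 i :=
  [set j | [&& j != i, ~~ adj E i j & [exists u, adj E i u && adj E u j]]].

Lemma card_edges_through2 i j : i != j ->
  #|[set e in E | (i \in e) && (j \in e)]| = adj E i j.
Proof.
move=> iNj; case: (boolP (adj E i j)) => [/adjP[_ [e [Ee ie je]]]|nij].
  apply/eqP/cards1P; exists e; apply/setP=> f; rewrite !inE.
  apply/idP/eqP => [/andP[Ef /andP[if_ jf]]|->]; last by rewrite Ee ie je.
  exact: (linear_edges acE Ef Ee iNj).
apply/eqP; rewrite cards_eq0; apply/eqP/setP=> e; rewrite !inE.
apply: contraNF nij => /andP[Ee /andP[ie je]].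
by apply/adjP; split=> //; exists e.
Qed.

Lemma card_edgeD1 e i : e \in E -> i \in e -> #|e :\ i| = t.
Proof. by move=> Ee ie; have := cardsD1 i e; rewrite ie (unifE Ee) => -[]. Qed.

(** Double counting: by linearity each neighbour of [i] lies in exactly one edge through [i]. *)
Lemma card_nbr i : #|nbr i| = #|[set e in E | i \in e]| * t.
Proof.
rewrite -sum_nat_const -[LHS]sum1dep_card.
rewrite (eq_bigl (fun j => (j != i) && adj E i j)); last first.
  by move=> j; rewrite {2}/adj [j == i]eq_sym andbA andbb.
rewrite big_mkcondr /=.
under eq_bigr => j jNi.
  have -> : (if adj E i j then 1 else 0) = adj E i j by case: (adj E i j).
  rewrite -card_edges_through2 1?eq_sym // -sum1dep_card; over.
rewrite (exchange_big_dep (fun e => (e \in E) && (i \in e))) /=; last first.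
  by move=> j e _ /andP[-> /andP[]].
apply: eq_big => [e|e /andP[Ee ie]]; first by rewrite inE.
rewrite -(card_edgeD1 Ee ie) -sum1_card; apply: eq_bigl => j.
by rewrite !inE Ee ie.
Qed.

(** These are the off-diagonal entries of $P^2$: adjacent vertices share the rest of their edge,
    nonadjacent ones at most one neighbour. *)
Lemma card_common_adj i j : i != j ->
  #|[set u | adj E i u && adj E u j]| = adj E i j * t.-1 + (j \in nbr2 i).
Proof.
move=> iNj; rewrite inE [j == i]eq_sym iNj /=.
case: (boolP (adj E i j)) => [/adjP[_ [e [Ee ie je]]]|nij] /=.
  rewrite mul1n addn0 -(card_edgeD1 Ee ie) [in RHS](cardsD1 j) !inE je eq_sym iNj /=.
  apply: eq_card => u; rewrite !inE.
  apply/idP/idP => [/andP[/adjP[iNu [f [Ef if_ uf]]] /adjP[uNj [g [Eg ug jg]]]]|].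
    have efg := adj_triangle acE Ee Ef Eg iNj iNu uNj ie je if_ uf ug jg.
    rewrite -efg in jg.
    have <- := linear_edges acE Ef Ee iNj if_ jg ie je.
    by rewrite uNj eq_sym iNu.
  case/and3P=> uNj uNi ue; apply/andP; split; apply/adjP.
    by rewrite eq_sym; split=> //; exists e.
  by split=> //; exists e.
case: existsP => [[u /andP[iu uj]]|no_u].
  apply/eqP/cards1P; exists u; apply/setP=> v; rewrite !inE.
  apply/andP/eqP => [[iv vj]|->//].
  exact: (common_adj_unique acE nij iNj).
apply/eqP; rewrite cards_eq0; apply/eqP/setP=> u; rewrite !inE.
by apply/negP => uP; case: no_u; exists u.
Qed.

(** The formula for $P^2$ applied to a vector; a general [V] covers both counting in [int] and
    eigenvectors over [algC]. *)
Lemma sum_nbr_nbr (V : nmodType) (x : 'I_n -> V) j :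
  (\sum_(i in nbr j) \sum_(u in nbr i) x u =
   x j *+ #|nbr j| + (\sum_(u in nbr j) x u) *+ t.-1 + \sum_(u in nbr2 j) x u)%R.
Proof.
rewrite (exchange_big_dep xpredT) //= (bigD1 j) //= -addrA; congr (_ + _)%R.
  rewrite sumr_const; congr (_ *+ _)%R; apply: eq_card => i.
  by rewrite [LHS]unfold_in !inE [adj E i j]adjC andbb.
under eq_bigr => u uNj.
  rewrite sumr_const (_ : #|_| = #|[set i | adj E j i && adj E i u]|); last first.
    by apply: eq_card => i; rewrite [LHS]unfold_in !inE.
  rewrite card_common_adj 1?eq_sym // mulrnDr; over.
rewrite big_split /= -sumrMnl; congr (_ + _)%R.
  rewrite [LHS]big_mkcond [RHS]big_mkcond; apply: eq_bigr => u _; rewrite inE.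
  case: eqVneq => [->|_] /=; first by rewrite /adj eqxx.
  by case: (adj E j u); rewrite ?mul1n ?mul0n ?mulr0n.
rewrite [LHS]big_mkcond [RHS]big_mkcond; apply: eq_bigr => u _.
case: eqVneq => [->|_] /=; first by rewrite inE eqxx.
by case: (u \in nbr2 j).
Qed.

Hypothesis t_gt0 : 0 < t.

(** For the constant vector 1 the formula says that the neighbourhood sizes of the neighbours of [i]
    add up to [t * #|nbr i| + #|nbr2 i|]; each of these sizes is a multiple of [t]. *)
Lemma dvdn_ball2 i : t %| #|nbr i| + #|nbr2 i|.
Proof.
have eqN : \sum_(u in nbr i) #|nbr u| = #|nbr i| + #|nbr i| * t.-1 + #|nbr2 i|.
  apply/eqP; rewrite -(eqr_nat int) natr_sum !natrD natrM mulr_natr.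
  rewrite (eq_bigr (fun u => \sum_(v in nbr u) (1 : int))%R) => [|u _].
    by rewrite (sum_nbr_nbr (fun=> 1 : int)%R) !sumr_const.
  by rewrite sumr_const.
have dvdN u : t %| #|nbr u| by rewrite card_nbr dvdn_mull.
have : t %| \sum_(u in nbr i) #|nbr u| by apply: dvdn_sum.
rewrite eqN -mulnS prednK // dvdn_addr ?dvdn_mull // => dvd2.
by rewrite dvdn_addr.
Qed.

Lemma disjoint_nbr_nbr2 i : [disjoint nbr i & nbr2 i].
Proof.
by apply/pred0P => j /=; rewrite !inE; case: (adj E i j); rewrite ?andbF.
Qed.

(** [D] is meant for vertices at distance at least 3; the strict inequality accounts for [i]
    itself. *)
Lemma card_ball2 i (D : {set 'I_n}) : i \notin D -> [disjoint nbr i & D] ->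
  [disjoint nbr2 i & D] -> #|nbr i| + #|nbr2 i| + #|D| < n.
Proof.
move=> iD dis1 dis2.
have card12 : #|nbr i :|: nbr2 i| = #|nbr i| + #|nbr2 i|.
  by rewrite cardsU (disjoint_setI0 (disjoint_nbr_nbr2 i)) cards0 subn0.
have dis12 : [disjoint nbr i :|: nbr2 i & D].
  by rewrite disjoints_subset subUset -!disjoints_subset dis1.
have card12D : #|nbr i :|: nbr2 i :|: D| = #|nbr i| + #|nbr2 i| + #|D|.
  by rewrite cardsU (disjoint_setI0 dis12) cards0 subn0 card12.
have iB : i \notin nbr i :|: nbr2 i :|: D.
  by rewrite !inE (negbTE iD) eqxx /= /adj eqxx.
have := max_card (mem (i |: (nbr i :|: nbr2 i :|: D))).
by rewrite card_ord cardsU1 iB card12D.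
Qed.

Lemma card_ball2_le i : #|nbr i| + #|nbr2 i| <= t * ((n - 1) %/ t).
Proof.
have dis0 (A : {set 'I_n}) : [disjoint A & set0].
  by rewrite disjoint_sym disjoints_subset sub0set.
have := @card_ball2 i set0; rewrite inE cards0 addn0.
move=> /(_ isT (dis0 _) (dis0 _)) lt_n.
have /dvdnP[q eq_q] := dvdn_ball2 i.
by rewrite eq_q mulnC leq_mul2l leq_divRL // -eq_q; apply/orP; right; lia.
Qed.

(** The [t] vertices of the last edge other than [c] would all be at distance at least 3 from [i],
    but maximality leaves room for fewer than [t]. *)
Lemma ball2_max_nbw i e b : t * ((n - 1) %/ t) <= #|nbr i| + #|nbr2 i| ->
  ~ nbw E i 2 e b.
Proof.
move=> maxi w; have [Ee be [f [c [wc fNe ce cNb]]]] := w.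
have wz z : z \in e :\ c -> nbw E i 2 e z.
  by rewrite !inE => /andP[zNc ze]; apply: (@nbwS _ _ i 1 f c); rewrite // eq_sym.
have := @card_ball2 i (e :\ c); rewrite card_edgeD1 // => lt_n.
have /lt_n {}lt_n : i \notin e :\ c.
  by apply/negP => /wz /(nbw_open acE); rewrite eqxx.
have /lt_n {}lt_n : [disjoint nbr i & e :\ c].
  apply/pred0P => z /=; apply/negP => /andP[zi /wz].
  by move/(nbw1_nadj acE)/negP; apply; move: zi; rewrite inE.
have /lt_n {}lt_n : [disjoint nbr2 i & e :\ c].
  apply/pred0P => z /=; apply/negP => /andP[+ /wz wiz].
  rewrite inE => /and3P[_ _ /existsP[u]].
  by apply/negP; apply: nbw2_nadj wiz.
have := ltn_ceil (n - 1) t_gt0; rewrite mulSn mulnC; lia.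
Qed.

Lemma nbw1_nbr2 i e b : nbw E i 1 e b -> b \in nbr2 i.
Proof.
move=> w; rewrite inE eq_sym (nbw_open acE w) (nbw1_nadj acE w) /=.
have [Ee be [f [c [[Ef cf [if_ iNc]] fNe ce cNb]]]] := w.
apply/existsP; exists c; apply/andP; split; apply/adjP; split=> //.
  by exists f.
by exists e.
Qed.

Lemma nbw_prefix i q p e b : p <= q -> nbw E i q e b -> exists e' b', nbw E i p e' b'.
Proof.
elim: q e b => [|q IHq] e b; first by rewrite leqn0 => /eqP-> w; exists e, b.
rewrite leq_eqVlt => /predU1P[-> w|lt_p]; first by exists e, b.
by case=> _ _ [f [c [w _ _ _]]]; apply: IHq w.
Qed.

(** If [i0] is not a center, some walk [i0], [u], [j] with edges [e], [f] exists and [j] is in [M].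
    Then [u] is a center: a vertex [z] not adjacent to [u] would produce a three-edge walk starting
    in [M]. *)
Lemma exists_center (M : pred 'I_n) i0 : hconnected E -> M i0 ->
  (forall i, M i -> t * ((n - 1) %/ t) <= #|nbr i| + #|nbr2 i|) ->
  (forall i j, M i -> j \in nbr2 i -> M j) ->
  exists c, forall v, v != c -> adj E c v.
Proof.
move=> conE Mi maxM closM.
have short i e b : M i -> ~ nbw E i 2 e b by move/maxM/ball2_max_nbw; apply.
have [/forallP all_adj|] := boolP [forall v, (v != i0) ==> adj E i0 v].
  by exists i0 => v vN; apply: (implyP (all_adj v)).
rewrite negb_forall => /existsP[v]; rewrite negb_imply => /andP[vNi nadj_v].
have [[|q] [e w]] : exists q e, nbw E i0 q e v.
    by apply: connected_nbw; rewrite // eq_sym.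
  by case: w => Ee ve [ie iNv]; case/adjP: nadj_v; split=> //; exists e.
have [f [j wj]] := nbw_prefix (ltn0Sn q) w.
have Mj := closM _ _ Mi (nbw1_nbr2 wj).
case: wj {w} => Ef jf [{}e [u [[Ee ue [ie iNu]] eNf uf uNj]]].
have jNu : j != u by rewrite eq_sym.
have uNi : u != i0 by rewrite eq_sym.
have fNe : f != e by rewrite eq_sym.
exists u => z zNu; have uNz : u != z by rewrite eq_sym.
have [->|zNi] := eqVneq z i0; first by apply/adjP; split=> //; exists e.
have [q1 [g wz]] : exists q e, nbw E i0 q e z.
  by apply: connected_nbw; rewrite // eq_sym.
case: q1 wz => [|[|q1]] wz; last first.
- by have [e' [b' w']] := nbw_prefix (isT : 2 <= q1.+2) wz; case: (short _ _ _ Mi w').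
- have Mz := closM _ _ Mi (nbw1_nbr2 wz).
  case: wz => Eg zg [h [c [[Eh ch [ih iNc]] hNg cg cNz]]].
  have zNc : z != c by rewrite eq_sym.
  have [eq_he|hNe] := eqVneq h e; last first.
    (* The forbidden walk is [z], [c], [i0], [u]. *)
    case: (short z e u Mz).
    apply: (@nbwS _ _ z 1 h i0) => //.
    by apply: (@nbwS _ _ z 0 g c); rewrite // 1?eq_sym.
  have [eq_cu|cNu] := eqVneq c u; first by apply/adjP; rewrite -eq_cu; split=> //; exists g.
  (* The forbidden walk is [j], [u], [c], [z]. *)
  case: (short j g z Mj).
  rewrite eq_he in hNg ch.
  apply: (@nbwS _ _ j 1 e c) => //.
  by apply: (@nbwS _ _ j 0 f u); rewrite // 1?eq_sym.
- case: wz => Eg zg [ig iNz].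
  have [eq_ge|gNe] := eqVneq g e.
    by apply/adjP; split=> //; exists e; rewrite eq_ge in zg.
  (* The forbidden walk is [j], [u], [i0], [z]. *)
  case: (short j g z Mj).
  apply: (@nbwS _ _ j 1 e i0); rewrite // 1?eq_sym //.
  by apply: (@nbwS _ _ j 0 f u).
Qed.

(** Two vertices [u], [v] of an edge missing [c] would give a two-edge walk [c], [u], [v], although
    [v] is adjacent to [c]. *)
Lemma center_mem c e : (forall v, v != c -> adj E c v) -> e \in E -> c \in e.
Proof.
move=> adjc Ee; apply: contraT => cNe.
have /card_gt1P[u [v [ue ve uNv]]] : 1 < #|e| by rewrite unifE.
have neq x : x \in e -> x != c by apply: contraTneq => ->.
have /adjP[cNu [f [Ef cf uf]]] := adjc u (neq u ue).
have w : nbw E c 1 e v.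
  apply: (@nbwS _ _ c 0 f u) => //.
  by apply: contraNneq cNe => <-.
by case/negP: (nbw1_nadj acE w); apply: adjc (neq v ve).
Qed.

End UniformAcyclic.

Local Open Scope ring_scope.

(** * Eigenvectors *)

Section Spectrum.

Variables (n t : nat) (E : {set {set 'I_n}}).
Hypotheses (acE : acyclic E) (unifE : uniform t.+1 E) (t_gt0 : (0 < t)%N).

Local Notation nbr := (nbr E).
Local Notation nbr2 := (nbr2 E).

Lemma adjmx_adj i j : adjmx E i j = (adj E i j)%:R / t%:R.
Proof.
rewrite mxE; have [->|iNj] := eqVneq; first by rewrite /adj eqxx mul0r.
rewrite -(card_edges_through2 acE iNj) -sum1dep_card natr_sum mulr_suml.
apply: eq_big => [e|e /andP[Ee _]]; first by [].
by rewrite (unifE Ee) subSS subn0 mul1r.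
Qed.

Section Eigenvector.

Variables (l : algC) (v : 'rV[algC]_n).
Hypothesis eig_v : v *m adjmx E = l *: v.

Let t_neq0 : t%:R != 0 :> algC. Proof. by rewrite pnatr_eq0 -lt0n. Qed.

Lemma eigen_nbr j : t%:R * l * v 0 j = \sum_(i in nbr j) v 0 i.
Proof.
have := congr1 (fun M : 'rV_n => M 0 j) eig_v; rewrite !mxE => eq_j.
rewrite -mulrA -eq_j mulr_sumr [RHS]big_mkcond; apply: eq_bigr => i _.
rewrite adjmx_adj inE adjC; case: (adj E j i); last by rewrite mul0r !mulr0.
by rewrite mul1r mulrCA divff // mulr1.
Qed.

(** The left factor is $\mu^2-(t-1)\mu$ for the eigenvalue $\mu=tl$ of $P$. *)
Lemma eigen_ball2 j :
  t%:R * (t%:R * l ^+ 2 - t.-1%:R * l) * v 0 j =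
  #|nbr j|%:R * v 0 j + \sum_(u in nbr2 j) v 0 u.
Proof.
have eq2 : (t%:R * l) ^+ 2 * v 0 j = \sum_(i in nbr j) \sum_(u in nbr i) v 0 u.
  under eq_bigr => i _ do rewrite -eigen_nbr.
  by rewrite -mulr_sumr -eigen_nbr; ring.
rewrite mulrBr mulrBl.
have -> : t%:R * (t%:R * l ^+ 2) = (t%:R * l) ^+ 2 by ring.
rewrite eq2 (sum_nbr_nbr acE unifE) -eigen_nbr mulr_natl -mulr_natl.
ring.
Qed.

(** The previous identity is read at a coordinate of maximal modulus. If [K] reaches the bound,
    every estimate in the chain is tight, which fixes the row sum and the moduli on [nbr2 j]. *)
Lemma eigen_bound j (K := `|t%:R * l ^+ 2 - t.-1%:R * l|) :
    v 0 j != 0 -> (forall u, `|v 0 u| <= `|v 0 j|) ->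
  K <= ((n - 1) %/ t)%:R /\
  (((n - 1) %/ t)%:R <= K ->
     (t * ((n - 1) %/ t) <= #|nbr j| + #|nbr2 j|)%N /\
     forall u, u \in nbr2 j -> `|v 0 u| = `|v 0 j|).
Proof.
move=> vj_neq0 maxj; set m := ((n - 1) %/ t)%N.
have vj_gt0 : 0 < `|v 0 j| by rewrite normr_gt0.
have tR_gt0 : 0 < t%:R :> algC by rewrite ltr0n.
have le1 : t%:R * K * `|v 0 j| <=
    #|nbr j|%:R * `|v 0 j| + \sum_(u in nbr2 j) `|v 0 u|.
  rewrite -[t%:R]normr_nat -!normrM eigen_ball2 (le_trans (ler_normD _ _)) //.
  by rewrite normrM normr_nat lerD2l ler_norm_sum.
have sum_le : \sum_(u in nbr2 j) `|v 0 u| <= #|nbr2 j|%:R * `|v 0 j|.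
  by rewrite mulr_natl -sumr_const; apply: ler_sum.
have le2 : t%:R * K * `|v 0 j| <= (#|nbr j| + #|nbr2 j|)%:R * `|v 0 j|.
  by rewrite (le_trans le1) // natrD mulrDl lerD2l.
have le2' : t%:R * K <= (#|nbr j| + #|nbr2 j|)%:R by rewrite -(ler_pM2r vj_gt0).
have leB := card_ball2_le acE unifE t_gt0 j.
split.
  by rewrite -(ler_pM2l tR_gt0) (le_trans le2') // -natrM ler_nat.
rewrite -(ler_pM2l tR_gt0) -natrM => leK.
have leB' : (t * m <= #|nbr j| + #|nbr2 j|)%N.
  by rewrite -(ler_nat algC) (le_trans leK).
split=> // u u2; apply/eqP; rewrite eq_le maxj /=.
have eqB : (#|nbr j| + #|nbr2 j|)%N = (t * m)%N by apply/eqP; rewrite eqn_leq leB leB'.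
have : (#|nbr j| + #|nbr2 j|)%:R * `|v 0 j| <=
    #|nbr j|%:R * `|v 0 j| + \sum_(w in nbr2 j) `|v 0 w|.
  by rewrite eqB (le_trans _ le1) // ler_pM2r.
rewrite natrD mulrDl lerD2l mulr_natl -sumr_const.
rewrite (bigD1 u u2) [X in _ <= X](bigD1 u u2) /= => le_sum.
(* The other terms are at most the maximum, so the term of [u] has to reach it. *)
have le_rest : \sum_(i in nbr2 j | i != u) `|v 0 i| <= \sum_(i in nbr2 j | i != u) `|v 0 j|.
  by apply: ler_sum.
by rewrite -(lerD2r (\sum_(i in nbr2 j | i != u) `|v 0 j|)) (le_trans le_sum) // lerD2l.
Qed.

End Eigenvector.

End Spectrum.

(** The order of [algC] is partial; a maximum exists because norms are real, hence comparable. *)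
Lemma exists_max_norm (n : nat) (v : 'rV[algC]_n) : v != 0 ->
  exists2 i, v 0 i != 0 & forall j, `|v 0 j| <= `|v 0 i|.
Proof.
case/rV0Pn=> i0 vi0.
have := @comparable_arg_maxP _ _ _ i0 xpredT (fun i => `|v 0 i|) isT.
case=> [i j _ _|i _ maxi]; first exact: real_comparable (normr_real _) (normr_real _).
exists i => [|j]; last exact: maxi.
by rewrite -normr_gt0 (lt_le_trans _ (maxi i0 isT)) // normr_gt0.
Qed.

Lemma eigenvalue_hiso n (E1 E2 : {set {set 'I_n}}) l :
  hiso E1 E2 -> eigenvalue (adjmx E2) l -> eigenvalue (adjmx E1) l.
Proof.
case=> f [[g fK gK] ->] /eigenvalueP[v eig_v vN0].
have injf : injective f := can_inj fK.
have adjf i j : adjmx [set f @: e | e : {set 'I_n} in E1] (f i) (f j) = adjmx E1 i j.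
  rewrite !mxE (inj_eq injf); case: eqP => // _.
  rewrite [LHS]big_mkcondr big_imset /=; last by move=> e1 e2 _ _; apply: imset_inj.
  rewrite -big_mkcondr; apply: eq_big => [e|e _]; last by rewrite card_imset.
  by rewrite !mem_imset.
apply/eigenvalueP; exists (\row_i v 0 (f i)).
  apply/rowP=> j; have := congr1 (fun M : 'rV_n => M 0 (f j)) eig_v; rewrite !mxE => <-.
  rewrite [RHS](reindex f) /=; last by exists g => i _; [exact: fK | exact: gK].
  by apply: eq_bigr => i _; rewrite adjf mxE.
case/rV0Pn: vN0 => i vi; apply/rV0Pn; exists (g i); by rewrite mxE gK.
Qed.

(** * The superstar *)

(** Grouping by edges lets the eigenvector equation of the superstar be checked one edge at a
    time. *)
Lemma mulmx_adjmx n (E : {set {set 'I_n}}) (v : 'rV[algC]_n) j :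
  (v *m adjmx E) 0 j =
  \sum_(e in E | j \in e) (\sum_(i in e :\ j) v 0 i) / (#|e| - 1)%N%:R.
Proof.
rewrite mxE.
transitivity (\sum_i \sum_(e in E | [&& i != j, i \in e & j \in e])
                v 0 i / (#|e| - 1)%N%:R).
  apply: eq_bigr => i _; rewrite mxE.
  have [->|iNj] := eqVneq; first by rewrite mulr0 big_pred0 // => e; rewrite andbF.
  by rewrite mulr_sumr.
rewrite (exchange_big_dep (fun e => (e \in E) && (j \in e))) /=; last first.
  by move=> i e _ /andP[-> /and3P[_ _ ->]].
apply: eq_bigr => e /andP[Ee je]; rewrite mulr_suml; apply: eq_bigl => i.
by rewrite !inE Ee je andbT.
Qed.

Section Star.

Variables (n t : nat).
Hypotheses (t_gt0 : (0 < t)%N) (n_gt0 : (0 < n)%N).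
Local Notation m := ((n - 1) %/ t)%N.

(** The leaves are the labels from [j * t + 1] to [j * t + t] that exist; the block is full when
    [j < m]. *)
Definition star_edge (j : nat) : {set 'I_n} :=
  [set i : 'I_n | (val i == 0%N) || ((0 < val i)%N && ((val i - 1) %/ t == j)%N)].

Lemma superstarE : superstar n t.+1 = [set star_edge j | j : 'I_m].
Proof. by rewrite /superstar /star_edge subSS subn0. Qed.

Lemma star_center j : Ordinal n_gt0 \in star_edge j.
Proof. by rewrite inE. Qed.

Lemma card_star_leaves j : (j < m)%N -> #|star_edge j :\ Ordinal n_gt0| = t.
Proof.
move=> lt_j.
have lt_n (s : 'I_t) : (j * t + s + 1 < n)%N.
  have le1 : (j.+1 * t <= m * t)%N by rewrite leq_mul2r lt_j orbT.
  have le2 := leq_trunc_div (n - 1) t.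
  by have := ltn_ord s; rewrite mulSn in le1; lia.
pose h s := Ordinal (lt_n s).
have injh : injective h by move=> s1 s2 [eq_h]; apply/val_inj => /=; lia.
have -> : star_edge j :\ Ordinal n_gt0 = [set h s | s : 'I_t].
  apply/setP=> i; rewrite !inE -val_eqE /=; apply/idP/imsetP.
    case/andP=> iN0; rewrite (negbTE iN0) /= => /andP[i_gt0 /eqP eq_j].
    have lt_s : ((val i - 1) %% t < t)%N by rewrite ltn_mod.
    exists (Ordinal lt_s) => //; apply/val_inj => /=.
    by rewrite -eq_j -divn_eq subnK.
  case=> s _ -> /=; rewrite addn1 /= subn1 /= divnMDl // divn_small ?ltn_ord //.
  by rewrite addn0.
by rewrite card_imset // card_ord.
Qed.

Lemma card_star_edge j : (j < m)%N -> #|star_edge j| = t.+1.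
Proof.
by move=> lt_j; rewrite (cardsD1 (Ordinal n_gt0)) star_center card_star_leaves.
Qed.

Lemma star_edge_leaf i j : i != Ordinal n_gt0 ->
  (i \in star_edge j) = ((val i - 1) %/ t == j)%N.
Proof. by rewrite inE -val_eqE /= => iN0; rewrite (negbTE iN0) lt0n iN0. Qed.

Lemma star_edge_inj : {in [pred j | j < m]%N &, injective star_edge}.
Proof.
move=> j1 j2 lt1 _ eq_j.
have : (0 < #|star_edge j1 :\ Ordinal n_gt0|)%N by rewrite card_star_leaves.
case/card_gt0P=> i /setD1P[iN0 i1]; have := i1; rewrite eq_j.
by move: i1; rewrite !star_edge_leaf // => /eqP-> /eqP.
Qed.

Lemma star_eigenvalue (r : algC) : (0 < m)%N -> t%:R * r ^+ 2 - t.-1%:R * r = m%:R ->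
  eigenvalue (adjmx (superstar n t.+1)) r.
Proof.
move=> m_gt0 eq_r; set c := Ordinal n_gt0.
have tN0 : t%:R != 0 :> algC by rewrite pnatr_eq0 -lt0n.
(* The vector is 1 on leaves and 0 past the last full block, where vertices lie in no edge. The leaf
   equation $x_0+(t-1)=tr$ forces [x0], and the center equation $m=rx_0$ is then the quadratic. *)
pose x0 : algC := t%:R * r - t.-1%:R.
pose v : 'rV[algC]_n := \row_i (if i == c then x0 else ((val i - 1) %/ t < m)%N%:R).
have v_leaf i : i != c -> v 0 i = ((val i - 1) %/ t < m)%N%:R.
  by move=> iN; rewrite mxE (negbTE iN).
have vc : v 0 c = x0 by rewrite mxE eqxx.
have v_edge j i : (j < m)%N -> i \in star_edge j :\ c -> v 0 i = 1.
  move=> lt_j /setD1P[iN ij]; rewrite v_leaf //; move: ij.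
  by rewrite star_edge_leaf // => /eqP->; rewrite lt_j.
have sum_star j : (v *m adjmx (superstar n t.+1)) 0 j =
    \sum_(s < m | j \in star_edge s) (\sum_(i in star_edge s :\ j) v 0 i) / t%:R.
  rewrite mulmx_adjmx superstarE big_mkcondr big_imset /=.
    rewrite -big_mkcondr; apply: eq_bigr => s _.
    by rewrite card_star_edge // subSS subn0.
  by move=> s1 s2 _ _ eq_s; apply/val_inj; apply: star_edge_inj (ltn_ord s1) (ltn_ord s2) eq_s.
apply/eigenvalueP; exists v; last first.
  have : (0 < #|star_edge 0 :\ c|)%N by rewrite card_star_leaves.
  case/card_gt0P=> i i0; apply/rV0Pn; exists i.
  by rewrite (v_edge 0%N) // oner_neq0.
apply/rowP=> j; rewrite sum_star mxE; have [->|jNc] := eqVneq j c.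
  rewrite vc (eq_bigr (fun=> 1)) => [|s _].
    rewrite (eq_bigl xpredT) => [|s]; last exact: star_center.
    by rewrite sumr_const card_ord -eq_r /x0; ring.
  rewrite (eq_bigr (fun=> 1)) => [|i]; last exact: v_edge.
  by rewrite sumr_const card_star_leaves // divff.
rewrite v_leaf //; have [lt_s|ge_s] := ltnP; last first.
  rewrite mulr0 big_pred0 // => s; rewrite star_edge_leaf //.
  by apply/negP => /eqP eq_s; have := ltn_ord s; rewrite -eq_s ltnNge ge_s.
rewrite (big_pred1 (Ordinal lt_s)) => [|s]; last first.
  by rewrite star_edge_leaf // eq_sym -val_eqE.
set s := ((val j - 1) %/ t)%N in lt_s *.
have js : j \in star_edge s by rewrite star_edge_leaf.
rewrite (bigD1 c) /=; last by rewrite !inE eq_sym jNc.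
rewrite vc (eq_bigr (fun=> 1)) => [|i]; last first.
  rewrite !inE => /andP[/andP[_ i1] i2]; apply: (v_edge s) => //.
  by rewrite !inE i1 i2.
rewrite sumr_const.
have -> : #|[pred i | (i \in star_edge s :\ j) && (i != c)]| = t.-1.
  have := cardsD1 j (star_edge s :\ c); rewrite card_star_leaves // in_setD1 jNc js.
  move=> ->; apply: eq_card => i.
  by rewrite [LHS]inE !in_setD1 andbC andbA [X in _ = X]andbA [X in X && _ = _]andbC.
rewrite mulr1; apply: (mulIf tN0); rewrite divfK // /x0; ring.
Qed.

End Star.

(** * Isomorphism with the superstar, given a vertex adjacent to all others *)

Section CenterIso.

Variables (n t : nat) (E : {set {set 'I_n}}) (c : 'I_n).
Hypotheses (acE : acyclic E) (unifE : uniform t.+1 E) (t_gt0 : (0 < t)%N).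
Hypotheses (n_gt0 : (0 < n)%N) (adjc : forall v, v != c -> adj E c v).

Let c_mem e : e \in E -> c \in e.
Proof. exact: (center_mem acE unifE). Qed.

(** All edges pass through [c] and [nbr E c] is everything else; in particular [t] divides
    [n - 1]. *)
Lemma order_center : (n - 1 = #|E| * t)%N.
Proof.
have -> : #|E| = #|[set e in E | c \in e]|.
  by apply: eq_card => e; rewrite inE; apply/idP/andP => [Ee|[]//]; split=> //; apply: c_mem.
rewrite -(card_nbr acE unifE); have -> : nbr E c = [set~ c].
  by apply/setP=> v; rewrite !inE; apply/idP/idP => [/adjP[]|/adjc //]; rewrite eq_sym.
by rewrite cardsC1 card_ord subn1.
Qed.

Let edge (a : nat) : {set 'I_n} := nth set0 (enum E) a.

(** It sends superstar labels to vertices of [E], so its inverse is the isomorphism sought. By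
    [leaf_block] and [size_block] the default values of [nth] are never reached. *)
Definition center_iso (i : 'I_n) : 'I_n :=
  if val i == 0%N then c
  else nth c (enum (edge ((val i - 1) %/ t) :\ c)) ((val i - 1) %% t).

Lemma edge_mem a : (a < #|E|)%N -> edge a \in E.
Proof. by move=> lt_a; rewrite -mem_enum mem_nth // -cardE. Qed.

Lemma leaf_block (i : 'I_n) : val i != 0%N -> ((val i - 1) %/ t < #|E|)%N.
Proof. by rewrite ltn_divLR // -order_center; have := ltn_ord i; rewrite /=; lia. Qed.

Lemma size_block a : (a < #|E|)%N -> size (enum (edge a :\ c)) = t.
Proof.
move=> lt_a; have Ea := edge_mem lt_a.
by rewrite -cardE (card_edgeD1 unifE) // c_mem.
Qed.

Lemma center_iso_leaf (i : 'I_n) : val i != 0%N ->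
  center_iso i \in edge ((val i - 1) %/ t) :\ c.
Proof.
move=> iN0; rewrite /center_iso (negbTE iN0) -mem_enum mem_nth //.
by rewrite size_block ?leaf_block // ltn_mod.
Qed.

Lemma center_iso_inj : injective center_iso.
Proof.
move=> i j eq_ij; apply/val_inj.
have [i0|iN0] := eqVneq (val i) 0%N; have [j0|jN0] := eqVneq (val j) 0%N.
- by rewrite i0 j0.
- have := center_iso_leaf jN0; rewrite -eq_ij /center_iso i0 eqxx.
  by rewrite !inE eqxx.
- have := center_iso_leaf iN0; rewrite eq_ij /center_iso j0 eqxx.
  by rewrite !inE eqxx.
have mi := center_iso_leaf iN0; have mj := center_iso_leaf jN0.
rewrite -eq_ij in mj; case/setD1P: mi => giN mi; case/setD1P: mj => _ mj.
have Ei := edge_mem (leaf_block iN0); have Ej := edge_mem (leaf_block jN0).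
(* The common image and [c] are two vertices shared by both edges. *)
have eq_edge := linear_edges acE Ei Ej giN mi (c_mem Ei) mj (c_mem Ej).
have eq_q : ((val i - 1) %/ t = (val j - 1) %/ t)%N.
  apply/eqP; rewrite -(@nth_uniq _ set0 (enum E)) ?enum_uniq -?cardE ?leaf_block //.
  by apply/eqP.
have eq_r : ((val i - 1) %% t = (val j - 1) %% t)%N.
  move: eq_ij; rewrite /center_iso (negbTE iN0) (negbTE jN0) -eq_q => /eqP.
  by rewrite nth_uniq ?enum_uniq ?size_block ?leaf_block ?ltn_mod // => /eqP.
have := divn_eq (val i - 1) t; rewrite eq_q eq_r -divn_eq; lia.
Qed.

Lemma center_iso_edge a : (a < #|E|)%N -> center_iso @: star_edge n t a = edge a.
Proof.
move=> lt_a; have Ea := edge_mem lt_a.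
apply/eqP; rewrite eqEcard (unifE Ea) card_imset; last exact: center_iso_inj.
rewrite (card_star_edge t_gt0 n_gt0) ?leqnn ?andbT; last by rewrite order_center mulnK.
apply/subsetP=> _ /imsetP[i + ->]; rewrite inE.
have [i0 _|iN0 /= /andP[_ /eqP eq_a]] := eqVneq (val i) 0%N.
  by rewrite /center_iso i0 eqxx c_mem.
by have := center_iso_leaf iN0; rewrite eq_a => /setD1P[].
Qed.

Lemma hiso_superstar : hiso E (superstar n t.+1).
Proof.
have [f gK fK] := injF_bij center_iso_inj.
have eq_m : ((n - 1) %/ t = #|E|)%N by rewrite order_center mulnK.
have f_edge a : (a < #|E|)%N -> f @: edge a = star_edge n t a.
  move=> lt_a; rewrite -center_iso_edge // -imset_comp.
  by rewrite (eq_imset _ (gK : f \o center_iso =1 id)) imset_id.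
exists f; split; first by exists center_iso.
rewrite superstarE; apply/setP=> e; apply/imsetP/imsetP.
  case=> a _ ->; have lt_a : (a < #|E|)%N by rewrite -eq_m.
  by exists (edge a); rewrite ?edge_mem // f_edge.
case=> e' Ee' ->; have lt_a : (index e' (enum E) < #|E|)%N.
  by rewrite cardE index_mem mem_enum.
have lt_m := lt_a; rewrite -eq_m in lt_m.
by exists (Ordinal lt_m) => //=; rewrite -f_edge // /edge nth_index // mem_enum.
Qed.

End CenterIso.

(** * The quadratic equation and the comparison of spectral radii *)

Lemma pos_quadratic_root (a b m : algC) : 0 < a -> 0 <= b -> 0 < m ->
  exists2 r, 0 < r & a * r ^+ 2 - b * r = m.
Proof.
move=> a_gt0 b_ge0 m_gt0.
pose s := sqrtC (b ^+ 2 + 4 * a * m).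
have d_gt0 : 0 < b ^+ 2 + 4 * a * m.
  by rewrite ltr_wpDl ?exprn_ge0 // !mulr_gt0 // ltr0n.
exists ((b + s) / (2 * a)).
  by rewrite divr_gt0 ?mulr_gt0 ?ltr0n // ltr_wpDl // sqrtC_gt0.
have sK : s ^+ 2 = b ^+ 2 + 4 * a * m by apply: sqrtCK.
have aN0 : a != 0 by rewrite gt_eqF.
have -> : a * ((b + s) / (2 * a)) ^+ 2 - b * ((b + s) / (2 * a)) = (s ^+ 2 - b ^+ 2) / (4 * a).
  by field.
by rewrite sK; field.
Qed.

(** In $s(as-b)$ both factors increase with $s$, and both are positive at $r$ because $m>0$. *)
Lemma quadratic_lt (a b r s m : algC) : 0 < a -> 0 < r -> 0 < m ->
  a * r ^+ 2 - b * r = m -> r < s -> m < a * s ^+ 2 - b * s.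
Proof.
move=> a_gt0 r_gt0 m_gt0 eq_m lt_rs.
have s_gt0 := lt_trans r_gt0 lt_rs.
have arb : 0 < a * r - b.
  by rewrite -(pmulr_rgt0 _ r_gt0); have -> : r * (a * r - b) = m by rewrite -eq_m; ring.
have -> : a * s ^+ 2 - b * s = s * (a * s - b) by ring.
have -> : m = r * (a * r - b) by rewrite -eq_m; ring.
by rewrite ltr_pM ?ltW // ltrD2r // ltr_pM2l.
Qed.

Lemma uniform_order1_superstar n k (E : {set {set 'I_n}}) :
  (1 < k)%N -> n = 1%N -> uniform k E -> E = superstar n k.
Proof.
move=> k_gt1 n1 unifE.
have -> : E = set0.
  apply/setP=> e; rewrite inE; apply/negP=> Ee.
  by have := max_card (mem e); rewrite unifE // card_ord n1 leqNgt k_gt1.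
apply/setP=> e; rewrite inE; apply/esym/negP => /imsetP[[j lt_j] _ _].
by move: lt_j; rewrite n1 div0n.
Qed.

Theorem theorem1p1 (k n : nat) (E : {set {set 'I_n}}) :
  (3 <= k)%N -> (0 < n)%N ->
  uniform k E -> supertree E ->
  forall rG rS : algC,
    spectral_radius (adjmx E) rG ->
    spectral_radius (adjmx (superstar n k)) rS ->
    rG <= rS /\ (rG = rS <-> hiso E (superstar n k)).
Proof.
move=> k_ge3 n_gt0 unifE [_ conE acE] rG rS [[l eig_l norm_l] maxG] [[l' eig_l' norm_l'] maxS].
have iso_le : hiso E (superstar n k) -> rS <= rG.
  by move=> iso; rewrite -norm_l'; apply/maxG/(eigenvalue_hiso iso).
(* A single vertex gives [m = 0], while the quadratic argument relies on [m > 0]. *)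
have [n1|n_neq1] := eqVneq n 1%N.
  have eqE : E = superstar n k by apply: uniform_order1_superstar; rewrite // ltnW.
  have iso : hiso E (superstar n k).
    exists id; split; first by exists id.
    rewrite -eqE; apply/setP=> e; apply/idP/imsetP => [Ee|[e' Ee' ->]].
      by exists e; rewrite ?imset_id.
    by rewrite imset_id.
  have eq_r : rG = rS.
    by apply/eqP; rewrite eq_le iso_le // andbT -norm_l maxS // -eqE.
  by rewrite eq_r lexx; split.
case: k k_ge3 unifE iso_le maxS eig_l' => [//|t] t_gt1 unifE iso_le maxS _.
rewrite ltnS in t_gt1; have t_gt0 : (0 < t)%N := ltnW t_gt1.
have m_gt0 : (0 < (n - 1) %/ t)%N.
  have n_gt1 : (1 < n)%N by lia.
  have [e0 [es [/andP[Ee0 _] _ _ _]]] := conE (Ordinal n_gt0) (Ordinal n_gt1) isT.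
  rewrite divn_gt0 //; have := max_card (mem e0); rewrite unifE // card_ord; lia.
set m := ((n - 1) %/ t)%N in m_gt0.
have tR_gt0 : 0 < t%:R :> algC by rewrite ltr0n.
have mR_gt0 : 0 < m%:R :> algC by rewrite ltr0n.
have [r r_gt0 eq_r] := pos_quadratic_root tR_gt0 (ler0n _ t.-1) mR_gt0.
have le_rS : r <= rS.
  by rewrite -(ger0_norm (ltW r_gt0)) maxS // star_eigenvalue.
have /eigenvalueP[v eig_v vN0] := eig_l.
have [i0 vi0 maxi0] := exists_max_norm vN0.
pose K := `|t%:R * l ^+ 2 - t.-1%:R * l|.
(* Reverse triangle inequality, [rG] being the modulus of [l]. *)
have le_fK : t%:R * rG ^+ 2 - t.-1%:R * rG <= K.
  rewrite -norm_l; apply: le_trans (lerB_dist _ _).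
  by rewrite !normrM !normr_nat.
have [le_Km _] := eigen_bound acE unifE t_gt0 eig_v vi0 maxi0.
have rG_real : rG \is Num.real by rewrite -norm_l normr_real.
have le_rG : rG <= r.
  rewrite (real_leNgt rG_real (gtr0_real r_gt0)); apply/negP => lt_r.
  have := quadratic_lt tR_gt0 r_gt0 mR_gt0 eq_r lt_r.
  by move/lt_geF; rewrite (le_trans le_fK).
have le_GS := le_trans le_rG le_rS; split=> //; split; last first.
  by move=> iso; apply/eqP; rewrite eq_le le_GS iso_le.
(* Equality squeezes $r$ between [rG] and [rS], so [K] reaches [m] and the tight case of
   [eigen_bound] applies at every index of maximal modulus. *)
move=> eq_GS; have eq_rG : rG = r by apply/eqP; rewrite eq_le le_rG eq_GS.
have le_mK : m%:R <= K by rewrite -eq_r -eq_rG.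
pose M i := `|v 0 i| == `|v 0 i0|.
have [c adjc] : exists c, forall v, v != c -> adj E c v.
  have bnd i : M i -> v 0 i != 0 /\ forall u, `|v 0 u| <= `|v 0 i|.
    by move=> /eqP Mi; rewrite -normr_eq0 Mi normr_eq0.
  apply: (exists_center acE unifE t_gt0 (M := M) (i0 := i0)) => //.
  - exact: eqxx.
  - move=> i /bnd [vi maxi].
    by have [] := (eigen_bound acE unifE t_gt0 eig_v vi maxi).2 le_mK.
  - move=> i j Mi j2; have [vi maxi] := bnd i Mi.
    have [_ /(_ j j2) eq_j] := (eigen_bound acE unifE t_gt0 eig_v vi maxi).2 le_mK.
    by rewrite /M eq_j.
exact: hiso_superstar adjc.
Qed.
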